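(* Let $\Omega$ be an infinite set and let $S$ be a proper subsemigroup of $\Omega^\Omega$ satisfying either of the following: (i) $S$ has finite relative rank in $\Omega^\Omega$; (ii) $|S|\leq|\Omega|$. Then $S$ is contained in a maximal subsemigroup of $\Omega^\Omega$.
   Context: $\Omega^\Omega$ is the semigroup of all mappings from $\Omega$ to itself under composition. A subsemigroup $T$ of a semigroup $S$ is a maximal subsemigroup if $T\neq S$ and the subsemigroup $\langle T,s\rangle$ generated by $T$ and $s$ equals $S$ for all $s\in S\setminus T$. The relative rank of a subset $T$ of a semigroup $S$ is the least cardinality of a subset $U$ of $S$ such that the subsemigroup $\langle T,U\rangle$ generated by $T\cup U$ equals $S$. *)

(* Defs.v *)
From HB Require Import structures.
From mathcomp Require Import all_boot monoid.
From mathcomp Require Import boolp classical_sets functions cardinality.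
Set Implicit Arguments.
Unset Strict Implicit.
Unset Printing Implicit Defensive.

Local Open Scope classical_set_scope.
Local Open Scope card_scope.

Section Subsemigroups.
Variable G : semigroupType.
Implicit Types (A T U V : set G).

(* The empty set is allowed as a subsemigroup; this does not affect
   [maximal_subsemigroup] on a semigroup that is not generated by each of its
   elements. *)
Definition subsemigroup A := forall f g, A f -> A g -> A (f * g)%g.

Definition generated A : set G := smallest subsemigroup A.

Definition maximal_subsemigroup T :=
  [/\ subsemigroup T, T <> [set: G]
    & forall s, ~ T s -> generated (T `|` [set s]) = [set: G]].

Definition generates_with T U := generated (T `|` U) = [set: G].

(* Cardinals are represented by sets up to [#=]: the relative rank of [T] is the
   cardinality of any [U] such that [attains_relative_rank T U]. *)
Definition attains_relative_rank T U :=
  generates_with T U /\ forall V, generates_with T V -> U #<= V.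

Definition finite_relative_rank T :=
  exists2 U, attains_relative_rank T U & finite_set U.

End Subsemigroups.

Definition transformation (Omega : Type) : Type := Omega -> Omega.

Section FullTransformationSemigroup.
Variable Omega : Type.

Definition transformation_mul (f g : transformation Omega) :
  transformation Omega := f \o g.

Fact transformation_mulA : associative transformation_mul.
Proof. by []. Qed.

HB.instance Definition _ := gen_eqMixin (transformation Omega).
HB.instance Definition _ := gen_choiceMixin (transformation Omega).
HB.instance Definition _ :=
  isSemigroup.Build (transformation Omega) transformation_mulA.

End FullTransformationSemigroup.

(* Main.v *)
Require Import Defs.
From mathcomp Require Import all_boot monoid.
From mathcomp Require Import boolp classical_sets functions cardinality.
From mathcomp Require Import wochoice.
From Stdlib Require Import Wellfounded.
Local Open Scope classical_set_scope.
Local Open Scope card_scope.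
Set Implicit Arguments.
Unset Strict Implicit.

(** If finitely many elements generate the whole semigroup together with [S],
    then a union of a chain of proper subsemigroups above [S] is still proper:
    otherwise one member of the chain would already contain the finitely many
    generators. Zorn's lemma then yields a maximal subsemigroup
    ([maximal_subsemigroup_above]), which settles the case of finite relative
    rank.

    When [S] has at most as many elements as Omega, it is enough to embed [S] in
    a proper subsemigroup that generates everything together with one more map.
    Fix a subset Gamma of Omega and add to [S] all maps [f \o s] with [f] constant
    on Gamma and [s] in [S] or [s = id]. This [collapse_hull] is a subsemigroup,
    because composing on the left preserves being constant on Gamma.

    - If the complement of Gamma has the cardinality of Omega, there is an
      injection [alpha] of Omega into it, and any map [h] is
      [(h \o beta) \o alpha], where [beta] is a left inverse of [alpha] that is
      constant on Gamma. So the hull and [alpha] generate all maps.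
    - If Gamma contains two points of the range of every injective [s] in [S] or
      equal to [id], then no added map is injective: [f \o s] can only be
      injective if [s] is, and then [f] identifies two values of [s]. As there are
      more injections than elements of [S], the hull is proper.

    Such a Gamma exists ([set_meeting_ranges_twice]): there are at most as many
    ranges to meet as points in Omega, and each of them has the cardinality of
    Omega, so three points can be chosen in each range, all choices being
    distinct. The choice is a transfinite recursion along a well-order of Omega
    whose proper initial segments are too small to contain a copy of Omega, so
    that no range is exhausted before its turn. Making several choices
    per range uses that Omega and Omega * nat are equinumerous. *)

(** * Choosing distinct points in the ranges of injections *)

Lemma well_founded_total_order (T : Type) :
  exists2 lt : T -> T -> Prop, well_founded lt &
    forall x y, x <> y -> lt x y \/ lt y x.
Proof.
have [R Rwo] := well_ordering_principle {classic T}.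
exists (fun x y : {classic T} => ~~ R y x).
  move=> x; apply: contrapT => nAx.
  have [|m [[mA mmin] _]] := Rwo [pred y | `[<~ Acc (fun x y => ~~ R y x) y>]].
    by exists x; apply/asboolP.
  move/asboolP: mA; apply; constructor => y; apply: contraNP => nAy.
  by apply: mmin; apply/asboolP.
move=> x y xy; apply: contrapT => /not_orP[/negP/negPn Ryx /negP/negPn Rxy].
have Rrefl z : R z z.
  have [|m [[/eqP <- mmin] _]] := Rwo (pred1 (z : {classic T})).
    by exists z; exact: eqxx.
  by apply: mmin; exact: eqxx.
have [|m [_ muniq]] := Rwo (pred2 (x : {classic T}) y).
  by exists x; rewrite inE eqxx.
apply: xy; rewrite -(muniq x) ?(muniq y) //; split; rewrite ?inE ?eqxx ?orbT //.
  by move=> z /pred2P[]->.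
by move=> z /pred2P[]->.
Qed.

(** Start from any well-order. If some initial segment contains a copy of [T],
    take the least bound [a] of such a segment and pull the order back along the
    injection into it: an initial segment of the new order embeds in a segment
    with a bound below [a]. This is the order type of the cardinal of [T]. *)
Lemma initial_well_order (T : Type) :
  exists lt : T -> T -> Prop, [/\ well_founded lt,
    forall x y, x <> y -> lt x y \/ lt y x &
    forall a (h : T -> T), injective h -> ~ forall x, lt (h x) a].
Proof.
have [lt lt_wf lt_total] := well_founded_total_order T.
have [[a [h h_inj h_lt]]|no_h] := pselect (exists a,
    exists2 h : T -> T, injective h & forall x, lt (h x) a); last first.
  by exists lt; split=> // a h h_inj h_lt; apply: no_h; exists a, h.
elim: (lt_wf a) h h_inj h_lt => {}a _ IH h h_inj h_lt.
have [[b [ba [k k_inj k_lt]]]|no_k] := pselect (exists b, lt b a /\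
    exists2 k : T -> T, injective k & forall x, lt (k x) b).
  exact: IH k_inj k_lt.
exists (fun x y => lt (h x) (h y)); split.
- exact: wf_inverse_image.
- by move=> x y xy; apply: lt_total => /h_inj.
- move=> c k k_inj k_lt; apply: no_k; exists (h c); split=> //.
  by exists (h \o k) => //; exact: inj_comp.
Qed.

(** The points are chosen by recursion along an initial well-order. If every value
    of [a i] had been chosen before stage [i], sending [w] to the stage at which
    [a i w] was chosen would embed [T] in the initial segment of [i]. *)
Lemma injective_transversal (T : Type) (a : T -> T -> T) :
  (forall i, injective (a i)) ->
  exists f : T -> T, injective (fun i => a i (f i)).
Proof.
move=> a_inj; have [lt [lt_wf lt_total lt_init]] := initial_well_order T.
have fresh i (rec : forall j, lt j i -> T) :
    exists w, forall j (ji : lt j i), a i w <> a j (rec j ji).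
  apply: contrapT => /forallNP no_w.
  have {}no_w w : exists j, exists ji : lt j i, a i w = a j (rec j ji).
    have /existsNP[j /existsNP[ji /contrapT eq_w]] := no_w w.
    by exists j, ji.
  have [h h_eq] := choice no_w.
  apply: (lt_init i h) => [u v uv|u]; last by have [] := h_eq u.
  have [ju eq_u] := h_eq u; have [jv eq_v] := h_eq v.
  apply: (a_inj i); rewrite eq_u eq_v; move: ju jv {eq_u eq_v}.
  by rewrite uv => ju jv; rewrite (Prop_irrelevance ju jv).
pose step i rec := sval (cid (fresh i rec)).
pose f := Fix lt_wf _ step.
have fE i : f i = step i (fun j _ => f j).
  rewrite /f Fix_eq // => j g g' gg'; congr step.
  apply: functional_extensionality_dep => k.
  exact: functional_extensionality_dep.
have f_fresh i j : lt j i -> a i (f i) <> a j (f j).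
  by rewrite {1}fE /step; case: cid => w /= + ji; apply.
exists f => i j eq_ij; apply: contrapT => /lt_total[ij|ji].
  exact: f_fresh ij (esym eq_ij).
exact: f_fresh ji eq_ij.
Qed.

(** * Absorbing a countable factor *)

(** A maximal family of injective sequences with disjoint ranges misses only
    finitely many points. Attaching these to the block of one of the sequences
    partitions [T] into countable blocks, and each block [B] contains
    an infinite sequence, so that [B * nat] embeds in [B]. *)
Lemma infinite_prod_nat_injection (T : Type) :
  infinite_set [set: T] -> exists e : T * nat -> T, injective e.
Proof.
move=> Tinf; pose P (F : set (nat -> T)) := (forall s, F s -> injective s) /\
  (forall s t m n, F s -> F t -> s m = t n -> s = t).
have infinite_seq (A : set T) : infinite_set A ->
    exists2 s : nat -> T, injective s & forall n, A (s n).
  move/infiniteP; elim/Ppointed: T => T in A Tinf P *.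
    by case: Tinf; rewrite emptyE.
  move=> /pcard_leP[s]; exists s; first by move=> m n; apply: inj; rewrite inE.
  by move=> n; apply: funS.
have [C CP Ctot|F [[F_inj F_disj] F_max]] := @Zorn_bigcup _ P.
  split=> [s [X CX Xs]|s t m n [X CX Xs] [Y CY Yt]].
    by have [+ _] := CP _ CX; apply.
  have [XY|YX] := Ctot _ _ CX CY.
    by have [_] := CP _ CY; apply=> //; exact: XY.
  by have [_] := CP _ CX; apply=> //; exact: YX.
pose L := [set x | forall s n, F s -> s n <> x].
have L_fin : finite_set L.
  apply: contrapT => /infinite_seq[s s_inj sL].
  have nFs : ~ F s by move=> Fs; exact: sL 0 s 0 Fs erefl.
  apply: (F_max (s |` F)).
    by split=> [|/(_ s (or_introl erefl))//]; exact: subsetUr.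
  split=> [t [->//|/F_inj//]|t u m n [->|Ft] [->|Fu] // eq_mn].
  - by have := sL m _ n Fu (esym eq_mn).
  - by have := sL n _ m Ft eq_mn.
  - exact: F_disj eq_mn.
have [s0 Fs0] : exists s, F s.
  apply: contrapT => /forallNP F0; apply: Tinf.
  by apply: sub_finite_set L_fin => x _ s n /F0.
have /choice[b b_spec] x : exists s, F s /\ (L x /\ s = s0 \/ range s x).
  have [Lx|] := pselect (L x); first by exists s0; split=> //; left.
  move=> /existsNP[s /existsNP[n /not_implyP[Fs /contrapT sn]]].
  by exists s; split=> //; right; exists n.
have /choice[q q_inj] s :
    exists q : T -> nat, {in b @^-1` [set s] &, injective q}.
  apply/countable_injP.
  apply: (@sub_countable _ _ _ (\bigcup_(i : bool) if i then L else range s)).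
    apply: subset_card_le => x /= <-.
    by have [_ [[Lx _]|]] := b_spec x; [exists true|exists false].
  apply: bigcup_countable => // -[] _; first exact: finite_set_countable.
  exact: sub_countable (card_image_le _ _) _.
(* The block of x is b x, its position there is q (b x) x. *)
exists (fun xn => b xn.1 (pickle (q (b xn.1) xn.1, xn.2))) => -[x m] [y n] /=.
move=> eq_xy; have [Fx _] := b_spec x; have [Fy _] := b_spec y.
have bxy := F_disj _ _ _ _ Fx Fy eq_xy.
move: eq_xy; rewrite bxy => /(F_inj _ Fy)/(pcan_inj pickleK)[q_eq ->].
by rewrite (q_inj (b y) x y) ?inE.
Qed.

(** Among three distinct points chosen in the range of each [a i], the first ones
    are kept out of [Gamma], which makes its complement large, and the other
    two lie in it. *)
Lemma set_meeting_ranges_twice (T : Type) (a : T -> T -> T) :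
  infinite_set [set: T] -> (forall i, injective (a i)) ->
  exists Gamma : set T,
    (exists2 alpha : T -> T, injective alpha & forall x, ~ Gamma (alpha x)) /\
    forall i, exists u v, [/\ u <> v, Gamma (a i u) & Gamma (a i v)].
Proof.
move=> /infinite_prod_nat_injection[e e_inj] a_inj.
have /choice[p pK] x : exists im, forall im', e im' = x -> im = im'.
  have [[im _ <-]|no_im] := pselect (range e x); first by exists im => im' /e_inj.
  by exists (x, 0) => im' im'x; case: no_im; exists im'.
have {}pK im : p (e im) = im by exact: pK.
(* Each a i occurs in this family once for every natural number. *)
have [f f_inj] := injective_transversal (fun k => a_inj (p k).1).
pose phi i m := a i (f (e (i, m))).
have phi_inj i m i' m' : phi i m = phi i' m' -> (i, m) = (i', m').
  move=> eq_phi; apply/e_inj/f_inj; rewrite !pK; exact: eq_phi.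
exists [set x | forall i, phi i 0 <> x]; split.
  exists (phi^~ 0) => [i i' /phi_inj[]//|i]; exact.
move=> i; exists (f (e (i, 1))), (f (e (i, 2))); split.
- by move=> /(congr1 (a i)) /phi_inj.
- by move=> i' /phi_inj.
- by move=> i' /phi_inj.
Qed.

(** Cantor's diagonal argument within the injections: whatever the value of [j] at
    [x] among the two points [e (x, 0)] and [e (x, 1)], [j] is injective. *)
Lemma injection_outside (T : Type) (a : T -> T -> T) : infinite_set [set: T] ->
  exists2 j : T -> T, injective j & forall i, a i <> j.
Proof.
move=> /infinite_prod_nat_injection[e e_inj].
exists (fun x => e (x, `[< a x x = e (x, 0) >] : nat)).
  by move=> x y /e_inj[].
move=> i /(congr1 (fun g => g i)) aj; move: (aj).
by case: asboolP => [-> /e_inj|].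
Qed.

Lemma card_le_enumeration (T U : Type) (A : set U) (u0 : U) :
  A #<= [set: T] -> exists a : T -> U, A `<=` range a.
Proof.
move=> /card_leP[g].
have /choice[a aP] i : exists u, forall s : A, val (g s) = i -> val s = u.
  have [[s <-]|no_s] := pselect (exists s, val (g s) = i).
    by exists (val s) => t /val_inj /inj -> //; rewrite inE.
  by exists u0 => s si; case: no_s; exists s.
exists a => s /mem_set As; exists (val (g (SigSub As))) => //.
by rewrite -(aP _ (SigSub As) erefl).
Qed.

(** * Subsemigroups of finite relative rank *)

Lemma finite_subset_chain_bigcup (T : Type) (C : set (set T)) (U : set T) :
  C !=set0 -> total_on C subset -> finite_set U ->
  U `<=` \bigcup_(X in C) X -> exists2 X, C X & U `<=` X.
Proof.
move=> [X0 CX0] Ctot; elim/Peq: T => T in C U X0 CX0 Ctot *.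
move=> /finite_seqP[s ->]; elim: s => [|u s IH] sub_us; first by exists X0.
have [|X CX sX] := IH.
  by move=> x /= xs; apply: sub_us; rewrite /= inE xs orbT.
have [|Y CY Yu] := sub_us u; first by rewrite /= inE eqxx.
have [XY|YX] := Ctot _ _ CX CY; [exists Y|exists X] => // x /=; rewrite inE.
  by case/predU1P => [->//|/sX/XY].
by case/predU1P => [->|/sX//]; exact: YX.
Qed.

Lemma generated_subsemigroup (G : semigroupType) (A : set G) :
  subsemigroup (generated A).
Proof.
move=> f g Af Ag X XA; have [Xsub _] := XA.
by apply: Xsub; [exact: Af X XA|exact: Ag X XA].
Qed.

Lemma maximal_subsemigroup_above (G : semigroupType) (S U : set G) :
  subsemigroup S -> S <> [set: G] -> finite_set U -> generates_with S U ->
  exists2 M, maximal_subsemigroup M & S `<=` M.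
Proof.
move=> Ssub SNT Ufin SU.
have full A : subsemigroup A -> S `<=` A -> U `<=` A -> A = [set: G].
  move=> Asub SA UA; apply/seteqP; split=> // x _.
  have : generated (S `|` U) x by rewrite SU.
  by apply: smallest_sub => // y [/SA|/UA].
(* Sets are considered only through their union with S, so that the empty chain
   needs no special bound: its union stands for S. *)
pose P A := subsemigroup (S `|` A) /\ S `|` A <> [set: G].
have [C CP Ctot|A [[Msub MNT] Mmax]] := @Zorn_bigcup _ P.
  have [->|/set0P[X0 CX0]] := eqVneq C set0.
    by rewrite bigcup_set0 /P setU0.
  have C'tot : total_on [set S `|` X | X in C] subset.
    move=> _ _ [X CX <-] [Y CY <-].
    by have [XY|YX] := Ctot _ _ CX CY; [left|right]; apply: setUS.
  have C'E : S `|` \bigcup_(X in C) X =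
      \bigcup_(X in [set S `|` X | X in C]) X.
    apply/seteqP; split=> [x [Sx|[X CX Xx]]|x [_ [X CX <-] [Sx|Xx]]].
    - by exists (S `|` X0); [exists X0|left].
    - by exists (S `|` X); [exists X|right].
    - by left.
    - by right; exists X.
  rewrite /P C'E; split=> [f g [X C'X Xf] [Y C'Y Yg]|C'T].
    have [XY|YX] := C'tot _ _ C'X C'Y; [exists Y|exists X] => //.
      by case: C'Y XY Yg => Z /CP[Zsub _] <- XY Yg; apply: Zsub => //; exact: XY.
    by case: C'X YX Xf => Z /CP[Zsub _] <- YX Xf; apply: Zsub => //; exact: YX.
  have [||_ [X CX <-] UX] := finite_subset_chain_bigcup _ C'tot Ufin.
  - by exists (S `|` X0); exists X0.
  - by rewrite C'T.
  - by have [Xsub] := CP _ CX; apply; apply: full => //; exact: subsetUl.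
exists (S `|` A); last exact: subsetUl.
split=> // s /not_orP[nSs nAs]; set B := generated _.
have subB : S `|` A `|` [set s] `<=` B by exact: sub_gen_smallest.
have Bsub : subsemigroup B by exact: generated_subsemigroup.
have SB : S `|` B = B by apply/setUidPr => x Sx; apply: subB; left; left.
apply: contrapT => BNT; apply: (Mmax B); last by rewrite /P SB.
split=> [x Ax|BA]; first by apply: subB; left; right.
by apply: nAs; apply: BA; apply: subB; right.
Qed.

(** * Adjoining the maps that are constant on a given set *)

Definition constant_on (T : Type) (Gamma : set T) (f : T -> T) :=
  forall x y, Gamma x -> Gamma y -> f x = f y.

(** When [S] is a subsemigroup, this is the subsemigroup generated by [S] and the
    maps constant on [Gamma]: in a product, everything to the left of the last
    such factor is absorbed by it. *)
Definition collapse_hull (T : Type) (Gamma : set T)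
    (S : set (transformation T)) : set (transformation T) :=
  S `|` [set g | exists f s,
           [/\ constant_on Gamma f, s = id \/ S s & g = f \o s]].

Lemma constant_on_comp (T : Type) (Gamma : set T) (k f : T -> T) :
  constant_on Gamma f -> constant_on Gamma (k \o f).
Proof. by move=> fG x y Gx Gy /=; rewrite (fG x y). Qed.

Lemma collapse_hull_subsemigroup (T : Type) (Gamma : set T)
    (S : set (transformation T)) :
  subsemigroup S -> subsemigroup (collapse_hull Gamma S).
Proof.
move=> Ssub g h Hg [Sh|[f [s [fG Ss ->]]]]; last first.
  by right; exists (g \o f), s; split=> //; exact: constant_on_comp.
case: Hg => [Sg|[f [s [fG Ss ->]]]]; first by left; exact: Ssub.
right; exists f, (s \o h); split=> //; right.
by case: Ss => [->//|Ss]; exact: Ssub.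
Qed.

(** A left inverse [beta] of [alpha] may take any value outside the range of
    [alpha], so it can be made constant on [Gamma]; then [h \o beta] is in the hull
    for every [h]. *)
Lemma collapse_hull_generates (T : Type) (Gamma : set T)
    (S : set (transformation T)) (alpha : transformation T) :
  injective alpha -> (forall x, ~ Gamma (alpha x)) ->
  generates_with (collapse_hull Gamma S) [set alpha].
Proof.
move=> alpha_inj alphaG; apply/seteqP; split=> // h _ X [Xsub subX].
suff [beta betaG betaK] :
    exists2 beta, constant_on Gamma beta & cancel alpha beta.
  have -> : h = ((h \o beta : transformation T) * alpha)%g.
    by apply/funext => x; rewrite -[RHS]/(h (beta (alpha x))) betaK.
  apply: Xsub; apply: subX; [left; right|by right].
  exists (h \o beta), id; split=> //; last by left.
  exact: constant_on_comp.
have [[o]|T0] := pselect (inhabited T); last first.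
  by exists id => x; case: T0; exists.
have /choice[beta beta_spec] x : exists y, (Gamma x -> y = o) /\
    (forall z, alpha z = x -> y = z).
  have [[z _ <-]|no_z] := pselect (range alpha x); last first.
    by exists o; split=> // z zx; case: no_z; exists z.
  by exists z; split=> [/alphaG//|u /alpha_inj].
exists beta => [x y Gx Gy|z]; last by have [_] := beta_spec (alpha z); apply.
by have [-> // _] := beta_spec x; have [-> // _] := beta_spec y.
Qed.

Lemma collapse_hull_injective (T : Type) (Gamma : set T)
    (S : set (transformation T)) (j : transformation T) :
  (forall s, injective s -> s = id \/ S s ->
     exists u v, [/\ u <> v, Gamma (s u) & Gamma (s v)]) ->
  injective j -> collapse_hull Gamma S j -> S j.
Proof.
move=> S_meets j_inj [//|[f [s [fG Ss j_eq]]]].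
have [|u [v [uv Gu Gv]]] := S_meets s _ Ss.
  by move=> x y xy; apply: j_inj; rewrite j_eq /= xy.
by case: uv; apply: j_inj; rewrite j_eq /=; exact: fG.
Qed.

Theorem proposition3p3 (Omega : Type) (S : set (transformation Omega)) :
  infinite_set [set: Omega] ->
  subsemigroup S -> S <> [set: transformation Omega] ->
  (finite_relative_rank S \/ S #<= [set: Omega]) ->
  exists2 M : set (transformation Omega),
    maximal_subsemigroup M & S `<=` M.
Proof.
move=> Oinf Ssub SNT [[U [SU _] Ufin]|Sle].
  exact: maximal_subsemigroup_above SU.
have [a Sa] := card_le_enumeration id Sle.
have [j j_inj j_out] := injection_outside a Oinf.
(* b is a with id in place of its non-injective members. *)
have /choice[b bP] i : exists f, injective f /\ (injective (a i) -> a i = f).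
  have [ai|nai] := pselect (injective (a i)); first by exists (a i).
  by exists id; split=> [|/nai]; first exact: inj_id.
have b_inj i : injective (b i) by have [] := bP i.
have [Gamma [[alpha alpha_inj alphaG] bG]] := set_meeting_ranges_twice Oinf b_inj.
have SG s : injective s -> s = id \/ S s ->
    exists u v, [/\ u <> v, Gamma (s u) & Gamma (s v)].
  move=> s_inj [->|/Sa[i _ ais]]; last first.
    by have [_ bi] := bP i; have := bG i; rewrite -bi ais.
  (* Two points of Gamma in the range of b o are two points in the range of id. *)
  have [o _] := infinite_setN0 Oinf; have [u [v [uv Gu Gv]]] := bG o.
  by exists (b o u), (b o v); split=> // /b_inj.
have HNT : collapse_hull Gamma S <> [set: transformation Omega].
  move=> HT; have /Sa[i _] : S j.
    by apply: (collapse_hull_injective SG j_inj); rewrite HT.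
  exact: j_out.
have Hgen := @collapse_hull_generates _ Gamma S alpha alpha_inj alphaG.
have [M Mmax HM] := maximal_subsemigroup_above
  (collapse_hull_subsemigroup Ssub) HNT (finite_set1 _) Hgen.
by exists M => // x Sx; apply: HM; left.
Qed.
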